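(* (a) Let $\psi$ be a bounded complexity measure, $A$ a nonempty closed class of decision tables from $\mathcal{M}_k^2$, and suppose $F_{\psi,A}$ is defined everywhere on $\omega$. Then $F_{\psi,A}$ is nondecreasing, and either there is a constant $c\ge 0$ with $F_{\psi,A}(n)\le c$ for all $n\in\omega$, or there is an infinite set $D\subseteq\omega$ with $F_{\psi,A}(n)\ge H_D(n)$ for all $n\in\omega$. (b) Let $\varphi:\omega\to\omega$ be a nondecreasing function with $\varphi(n)\ge n$ for all $n\in\omega$ and $\varphi(0)=0$. Then there exist a bounded complexity measure $\psi$ and a nonempty closed class $A$ of decision tables from $\mathcal{M}_k^2$ such that for every $n\in\omega$ the value $F_{\psi,A}(n)$ is defined and equals $\varphi(n)$.
   Context: Fix an integer $k\ge 2$; $\omega=\{0,1,2,\ldots\}$, $E_k=\{0,1,\ldots,k-1\}$, $E_2=\{0,1\}$. Let $P=\{f_i:i\in\omega\}$ be a set of attribute names ($f_i\ne f_j$ for $i\ne j$). $\mathcal{M}_k^2$ is the set of rectangular tables filled with numbers from $E_k$ whose columns are labeled with pairwise different attributes from $P$, whose rows are pairwise different, and in which each row is labeled with a decision from $E_2$. Tables without rows also belong to $\mathcal{M}_k^2$ and are all denoted $\Lambda$. Tables differing only by a permutation of rows are equal. $P(T)$ is the set of column attributes. $\mathcal{M}_k^2\mathcal{C}$ is the set of tables in which all rows have the same decision ($\Lambda$ included). $T(f_{i_1},\delta_1)\cdots(f_{i_m},\delta_m)$ is the table of rows of $T$ having values $\delta_1,\ldots,\delta_m$ in the columns labeled $f_{i_1},\ldots,f_{i_m}$.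 Operations: for $D\subseteq P(T)$, $I(D,T)$ deletes the columns labeled by $D$ and, in each group of rows coinciding on the remaining columns, keeps one row with the minimum decision; $I(P(T),T)=\Lambda$. For $\nu:E_k^{|P(T)|}\to E_2$, $J(\nu,T)$ replaces the decision of each row $\bar\delta$ by $\nu(\bar\delta)$. $[T]=\{J(\nu,I(D,T)):D\subseteq P(T),\nu:E_k^{|P(T)\setminus D|}\to E_2\}$; $[A]=\bigcup_{T\in A}[T]$; nonempty $A$ is a closed class if $[A]=A$. A $k$-decision tree: finite directed rooted tree with at least two nodes, root and its leaving edges unlabeled, terminal nodes labeled with decisions from $E_2$, other nodes labeled with attributes from $P$ whose leaving edges are labeled with numbers from $E_k$; $P(\Gamma)$ is the set of attributes at nodes. For a complete path $\tau=v_1,d_1,\ldots,v_m,d_m,v_{m+1}$ (root to terminal node), $F(\tau)$ is the empty word if $m=1$, else $f_{i_2}\cdots f_{i_m}$ where $v_j$ is labeled $f_{i_j}$; $T(\tau)=T$ if $m=1$, else $T(f_{i_2},\delta_2)\cdots(f_{i_m},\delta_m)$ with $d_j$ labeled $\delta_j$. For $T\ne\Lambda$, a deterministic decision tree for $T$: exactly one edge leaves the root, edges leaving any other nonterminal node have pairwise different labels, $P(\Gamma)\subseteq P(T)$, every row of $T$ lies in some $T(\tau)$, and for every complete path either $T(\tau)=\Lambda$ or all rows of $T(\tau)$ have the terminal node's decision. For $T\notin\mathcal{M}_k^2\mathcal{C}$, a strongly nondeterministic decision tree for $T$: all terminal nodes labeled $1$, $P(\Gamma)\subseteq P(T)$,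 every row with decision $1$ lies in some $T(\tau)$, and for every complete path either $T(\tau)=\Lambda$ or all rows of $T(\tau)$ have decision $1$. Let $B$ be the set of finite words over $P$ (with empty word $\lambda$). A complexity measure is $\psi:B\to\omega$ with $\psi(\alpha)=0$ iff $\alpha=\lambda$, invariant under permutation of letters, $\psi(\alpha_1)\le\psi(\alpha_1\alpha_2)\le\psi(\alpha_1)+\psi(\alpha_2)$; bounded if $\psi(\alpha)\ge|\alpha|$. $\psi(\Gamma)=\max_\tau\psi(F(\tau))$ over complete paths. For $T\ne\Lambda$: $\psi^d(T)$ is the minimum of $\psi(\Gamma)$ over deterministic decision trees for $T$; $\psi^s(T)=0$ if $T\in\mathcal{M}_k^2\mathcal{C}$ and otherwise the minimum of $\psi(\Gamma)$ over strongly nondeterministic decision trees; both are $0$ on $\Lambda$. $F_{\psi,A}(n)$ is undefined if $\{\psi^d(T):T\in A,\psi^s(T)\le n\}$ is infinite, and otherwise equals its maximum. For infinite $D=\{n_i:i\in\omega\}\subseteq\omega$ with $n_i<n_{i+1}$: $H_D(n)=0$ if $n<n_0$, $H_D(n)=n_i$ if $n_i\le n<n_{i+1}$. *)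

(* Defs.v *)
From HB Require Import structures.
From mathcomp Require Import all_boot.
From mathcomp Require Import finmap.
From mathcomp Require Import boolp classical_sets functions cardinality.

Set Implicit Arguments.
Unset Strict Implicit.
Unset Printing Implicit Defensive.

Local Open Scope classical_set_scope.
Local Open Scope nat_scope.

Section Tables.
Variable k : nat.

(* The attribute f_i is represented by its index i, so P = nat.  Decisions,   *)
(* the elements of E_2 = {0,1}, are booleans with false = 0 and true = 1.     *)
(* The rows of a table form a finite map from words over E_k (the contents of *)
(* the row) to decisions: rows are pairwise different and unordered.          *)
(* A table without columns is the same thing as a table without rows, and     *)
(* there is exactly one such table, Lambda.                                   *)
Definition raw_table := (seq nat * {fmap seq 'I_k -> bool})%type.

Definition wf_table (p : raw_table) : bool :=
  [&& uniq p.1,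
      [forall r : domf p.2, size (val r) == size p.1] &
      nilp p.1 == (domf p.2 == fset0)].

Record table := Table { raw_of_table : raw_table; _ : wf_table raw_of_table }.
HB.instance Definition _ := [isSub for raw_of_table].
HB.instance Definition _ := [Choice of table by <:].

Definition columns (T : table) : seq nat := (raw_of_table T).1.
Definition rows (T : table) : {fmap seq 'I_k -> bool} := (raw_of_table T).2.

Lemma wf_Lambda : wf_table ([::], fmap0).
Proof. by apply/and3P; split=> //; apply/forallP => -[r r0]; have := r0; rewrite inE. Qed.

Definition Lambda : table := Table wf_Lambda.

(* In the operations below mk_table yields Lambda only when no row or no      *)
(* column is left, see val_subtable, val_opI and val_opJ.                     *)
Definition mk_table (cols : seq nat) (rws : {fmap seq 'I_k -> bool}) : table :=
  insubd Lambda (cols, rws).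

Definition constant_tables : set table :=
  [set T | exists d : bool,
     forall r e, (rows T).[? r]%fmap = Some e -> e = d].

(* Value of the row r of T in the column f; None if T has no such column.     *)
Definition entry (T : table) (r : seq 'I_k) (f : nat) : option 'I_k :=
  onth r (index f (columns T)).

(* T (f_1, d_1) ... (f_m, d_m) *)
Definition subtable (T : table) (w : seq (nat * 'I_k)) : table :=
  mk_table (columns T)
    (filterf (rows T) (fun r => all (fun q => entry T r q.1 == Some q.2) w)).

(* The minimum of a set of booleans is their conjunction. *)
Definition opI (D : seq nat) (T : table) : table :=
  let restr (r : seq 'I_k) := mask [seq f \notin D | f <- columns T] r in
  mk_table [seq f <- columns T | f \notin D]
    [fmap r : [fset restr r | r in domf (rows T)]%fset =>
       [forall r0 : domf (rows T),
          (restr (val r0) == val r) ==> rows T r0]]%fmap.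

Lemma size_row (T : table) (r : domf (rows T)) :
  size (val r) == size (columns T).
Proof. by case: T r => T wfT r; case/and3P: (wfT) => _ /forallP/(_ r). Qed.

Definition row_tuple (T : table) (r : domf (rows T)) :
  (size (columns T)).-tuple 'I_k := Tuple (size_row r).

Definition opJ (T : table) (nu : (size (columns T)).-tuple 'I_k -> bool) : table :=
  mk_table (columns T) [fmap r : domf (rows T) => nu (row_tuple r)]%fmap.

Definition table_closure1 (T : table) : set table :=
  [set T' | exists2 D : seq nat, {subset D <= columns T} &
            exists nu : (size (columns (opI D T))).-tuple 'I_k -> bool,
              T' = @opJ (opI D T) nu].

Definition table_closure (A : set table) : set table :=
  \bigcup_(T in A) table_closure1 T.

Definition closed_class (A : set table) : Prop :=
  A !=set0 /\ table_closure A = A.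

Lemma val_mk_table cols rws : wf_table (cols, rws) ->
  raw_of_table (mk_table cols rws) = (cols, rws).
Proof. by move=> h; rewrite /mk_table /insubd insubT. Qed.

Lemma mk_table_Lambda cols rws : nilp cols || (domf rws == fset0) ->
  mk_table cols rws = Lambda.
Proof.
move=> h; rewrite /mk_table /insubd; case: insubP => //= u.
case: u => -[c w] wfu /= /and3P[_ _ /= /eqP e] [ec ew]; move: h; rewrite e orbb => w0.
have c0 : cols = [::] by apply/nilP; rewrite e.
apply: val_inj; rewrite /= ec ew c0; congr pair; apply/fmapP => r; rewrite fnd_fmap0 not_fnd //.
by apply/negP => rw; have := in_fset0 r; rewrite -(eqP w0) => /negP; apply.
Qed.

Lemma uniq_columns (T : table) : uniq (columns T).
Proof. by case: T => T wfT; case/and3P: (wfT). Qed.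

Lemma nilp_columns (T : table) : nilp (columns T) = (domf (rows T) == fset0).
Proof. by case: T => T wfT; case/and3P: (wfT) => _ _ /eqP. Qed.

Lemma size_rows (T : table) r : r \in domf (rows T) -> size r = size (columns T).
Proof. by move=> rT; exact/eqP/(size_row [` rT]%fset). Qed.

Lemma val_subtable (T : table) w :
  let rws :=
    filterf (rows T) (fun r => all (fun q => entry T r q.1 == Some q.2) w) in
  domf rws != fset0 -> raw_of_table (subtable T w) = (columns T, rws).
Proof.
move=> rws rws0; apply: val_mk_table; apply/and3P; split; first exact: uniq_columns.
  apply/forallP => r; apply/eqP/size_rows.
  by have := valP r; rewrite mem_filterf => /andP[].
apply/eqP; rewrite (negbTE rws0) nilp_columns; apply/negbTE.
apply: contra rws0 => /eqP T0; rewrite -fsubset0 -T0.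
by apply/fsubsetP => r; rewrite mem_filterf => /andP[].
Qed.

Lemma val_opJ (T : table) (nu : (size (columns T)).-tuple 'I_k -> bool) :
  raw_of_table (opJ nu) = (columns T, [fmap r : domf (rows T) => nu (row_tuple r)]%fmap).
Proof.
apply: val_mk_table; apply/and3P; split; first exact: uniq_columns.
  by apply/forallP => r; exact: size_row.
by rewrite /= nilp_columns.
Qed.

Lemma val_opI (D : seq nat) (T : table) : ~~ nilp [seq f <- columns T | f \notin D] ->
  let restr (r : seq 'I_k) := mask [seq f \notin D | f <- columns T] r in
  raw_of_table (opI D T) =
  ([seq f <- columns T | f \notin D],
   [fmap r : [fset restr r | r in domf (rows T)]%fset =>
      [forall r0 : domf (rows T), (restr (val r0) == val r) ==> rows T r0]]%fmap).
Proof.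
move=> c0 restr; apply: val_mk_table; apply/and3P; split.
- exact/filter_uniq/uniq_columns.
- apply/forallP => -[r /= rI]; have /imfsetP[r1 /= /size_rows sz ->] := rI.
  by rewrite size_mask ?size_map ?sz// size_filter count_map.
- rewrite /= (negbTE c0) eq_sym; apply/eqP/negbTE.
  have /fset0Pn[r rT] : domf (rows T) != fset0.
    rewrite -nilp_columns; apply: contra c0 => /nilP ->; by [].
  by apply/fset0Pn; exists (restr r); apply: in_imfset.
Qed.

End Tables.

Arguments Lambda {k}.

Section Trees.
Variable k : nat.

(* Nodes other than the root.  A query node has m.+1 >= 1 leaving edges;      *)
(* its i-th edge is labeled with lbl i and enters child i.                    *)
Inductive node : Type :=
| Terminal of bool
| Query (f : nat) (m : nat) (lbl : 'I_m.+1 -> 'I_k) (child : 'I_m.+1 -> node).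

(* The root has root_deg.+1 leaving edges, hence there are two nodes or more. *)
Record dtree := DTree { root_deg : nat; root_child : 'I_root_deg.+1 -> node }.

Fixpoint node_attrs (v : node) : seq nat :=
  match v with
  | Terminal _ => [::]
  | Query f m lbl child =>
      f :: flatten [seq node_attrs (child i) | i <- enum 'I_m.+1]
  end.

Definition attrs (G : dtree) : seq nat :=
  flatten [seq node_attrs (root_child i) | i <- enum 'I_(root_deg G).+1].

(* A complete path is recorded as the word of the pairs (attribute of a node, *)
(* label of the edge by which the path leaves it), together with the decision *)
(* at its terminal node.                                                      *)
Fixpoint node_paths (v : node) : seq (seq (nat * 'I_k) * bool) :=
  match v with
  | Terminal d => [:: ([::], d)]
  | Query f m lbl child =>
      flatten [seq [seq ((f, lbl i) :: t.1, t.2) | t <- node_paths (child i)]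
              | i <- enum 'I_m.+1]
  end.

Definition paths (G : dtree) : seq (seq (nat * 'I_k) * bool) :=
  flatten [seq node_paths (root_child i) | i <- enum 'I_(root_deg G).+1].

Fixpoint det_node (v : node) : Prop :=
  match v with
  | Terminal _ => True
  | Query _ _ lbl child => injective lbl /\ forall i, det_node (child i)
  end.

Definition sound_path (T : table k) (t : seq (nat * 'I_k) * bool) : Prop :=
  subtable T t.1 = Lambda \/
  forall r e, (rows (subtable T t.1)).[? r]%fmap = Some e -> e = t.2.

Definition deterministic_tree_for (T : table k) (G : dtree) : Prop :=
  [/\ root_deg G = 0,
      forall i, det_node (@root_child G i),
      {subset attrs G <= columns T},
      forall r, r \in domf (rows T) ->
        exists2 t, t \in paths G & r \in domf (rows (subtable T t.1)) &
      forall t, t \in paths G -> sound_path T t].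

Definition strongly_nondeterministic_tree_for (T : table k) (G : dtree) : Prop :=
  [/\ forall t, t \in paths G -> t.2 = true,
      {subset attrs G <= columns T},
      forall r, (rows T).[? r]%fmap = Some true ->
        exists2 t, t \in paths G & r \in domf (rows (subtable T t.1)) &
      forall t, t \in paths G -> sound_path T t].

End Trees.

Definition complexity_measure (psi : seq nat -> nat) : Prop :=
  [/\ forall a, psi a = 0 <-> a = [::],
      forall a b, perm_eq a b -> psi a = psi b,
      forall a b, psi a <= psi (a ++ b) &
      forall a b, psi (a ++ b) <= psi a + psi b].

Definition bounded_measure (psi : seq nat -> nat) : Prop :=
  complexity_measure psi /\ forall a, size a <= psi a.

Definition minimum (S : set nat) : nat :=
  xget 0 [set m | S m /\ forall n, S n -> m <= n].

Lemma minimumP (S : set nat) : S !=set0 ->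
  S (minimum S) /\ forall n, S n -> minimum S <= n.
Proof.
move=> [n0 Sn0]; rewrite /minimum; case: xgetP => [m _ //|noS].
have exS : exists n, `[< S n >] by exists n0; apply/asboolP.
case: (noS (ex_minn exS)); case: ex_minnP => m /asboolP Sm le_m.
by split=> // n Sn; apply/le_m/asboolP.
Qed.

Section Complexity.
Variables (k : nat) (psi : seq nat -> nat).

Definition psi_tree (G : dtree k) : nat :=
  \max_(t <- paths G) psi [seq q.1 | q <- t.1].

Definition psi_d (T : table k) : nat :=
  if T == Lambda then 0
  else minimum [set psi_tree G | G in deterministic_tree_for T].

(* Lambda belongs to constant_tables. *)
Definition psi_s (T : table k) : nat :=
  if T \in @constant_tables k then 0
  else minimum [set psi_tree G | G in strongly_nondeterministic_tree_for T].

(* The partial function F_{psi,A}; None means undefined. *)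
Definition F_fun (A : set (table k)) (n : nat) : option nat :=
  let S := [set psi_d T | T in [set T | A T /\ psi_s T <= n]] in
  if `[< finite_set S >] then Some (\max_(x <- fset_set S) x) else None.

End Complexity.

(* The increasing enumeration n_0 < n_1 < ... of an infinite set D. *)
Definition enumeration (D : set nat) : nat -> nat :=
  xget (id : nat -> nat) [set e : nat -> nat | (forall i, e i < e i.+1) /\ range e = D].

Lemma enumerationP (D : set nat) : infinite_set D ->
  (forall i, enumeration D i < enumeration D i.+1) /\ range (enumeration D) = D.
Proof.
move=> Dinf; rewrite /enumeration; case: xgetP => [e _ []//|noe].
have next n : exists m, (n <= m) && `[< D m >].
  apply: contrapT => nom; apply: Dinf; apply: (@sub_finite_set _ _ `I_n).
    move=> m Dm /=; rewrite ltnNge; apply/negP => nm; apply: nom.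
    by exists m; rewrite nm; apply/asboolP.
  exact: finite_II.
pose nx n := ex_minn (next n).
pose e i := iter i (fun x => nx x.+1) (nx 0).
have nxP n : [/\ n <= nx n, D (nx n) & forall m, n <= m -> D m -> nx n <= m].
  rewrite /nx; case: ex_minnP => m /andP[nm /asboolP Dm] mn; split=> // p np Dp.
  by apply: mn; rewrite np; apply/asboolP.
have eS i : e i < e i.+1 by have [] := nxP (e i).+1.
have eD i : D (e i) by case: i => [|i]; [have [] := nxP 0|have [] := nxP (e i).+1].
case: (noe e); split=> //; apply/seteqP; split=> [_ [i _ <-]//|x Dx].
have le_e i : i <= e i by elim: i => // i IH; exact: leq_ltn_trans IH (eS i).
have [i xi] : exists i, x <= e i by exists x.
elim: i xi => [|i IH] xi.
  by exists 0 => //; apply/eqP; rewrite eqn_leq xi andbT; have [_ _] := nxP 0; apply.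
have [/IH//|lt] := leqP x (e i).
exists i.+1 => //; apply/eqP; rewrite eqn_leq xi andbT.
by have [_ _] := nxP (e i).+1; apply.
Qed.

Definition H_fun (D : set nat) (n : nat) : nat :=
  let e := enumeration D in
  if n < e 0 then 0 else e (xget 0 [set i | e i <= n < e i.+1]).

(* Main.v *)
(* (a) Since psi_s <= psi_d, every table T in A whose psi_d exceeds g N yields the
   point n = psi_s T > N with n <= psi_d T <= g n.  So if g is unbounded, then
   D = {n | n <= g n} is infinite, and g n >= g (H_D n) >= H_D n.

   (b) Sort the attributes into infinite groups, the n-th group being
   {f | logn 2 f = n}, and let psi a be the maximum of the length of a and of the
   group numbers of its letters.  Let A consist of the tables whose columns are
   at most phi n attributes of a single group n.  For a nonconstant such table,
   psi_s >= n, as any useful path queries something, and psi_d <= phi n, by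
   querying all columns.  Equality psi_d = phi n with psi_s = n is attained by the
   table of all words of length phi n labeled with "some entry is k - 1": accepting
   needs one query, rejecting the zero row needs all of them. *)
Require Import Defs.
From mathcomp Require Import all_boot finmap.
From mathcomp Require Import boolp classical_sets functions cardinality.

Set Implicit Arguments.
Unset Strict Implicit.
Unset Printing Implicit Defensive.

Local Open Scope classical_set_scope.
Local Open Scope nat_scope.

(** * Paths of decision trees, and the inequality between [psi_s] and [psi_d] *)

Section Trees.
Context {k : nat}.
Implicit Types (T : table k) (G : dtree k) (w : seq (nat * 'I_k)).

(** When no row survives the filter, [subtable] is [Lambda], whose row map is empty as well. *)
Lemma rows_subtable T w :
  rows (subtable T w) =
  filterf (rows T) (fun r => all (fun q => entry T r q.1 == Some q.2) w).
Proof.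
set rws := filterf _ _.
have [rws0|rws0] := eqVneq (domf rws) fset0; last first.
  by rewrite /rows (val_subtable rws0).
rewrite /subtable mk_table_Lambda ?rws0 ?eqxx ?orbT//.
apply/fmapP => r; rewrite fnd_fmap0 not_fnd//.
by rewrite -[_ \in _]/(r \in domf rws) rws0 inE.
Qed.

Lemma fnd_subtable T w r :
  (rows (subtable T w)).[? r]%fmap =
  if all (fun q => entry T r q.1 == Some q.2) w then (rows T).[? r]%fmap
  else None.
Proof. by rewrite rows_subtable fnd_filterf. Qed.

Lemma mem_subtable T w r :
  (r \in domf (rows (subtable T w))) =
  (r \in domf (rows T)) && all (fun q => entry T r q.1 == Some q.2) w.
Proof. by rewrite rows_subtable mem_filterf. Qed.

Lemma sound_path_fnd T t r e : sound_path T t ->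
  (rows T).[? r]%fmap = Some e ->
  all (fun q => entry T r q.1 == Some q.2) t.1 -> e = t.2.
Proof.
move=> st Tr rt; have srt : (rows (subtable T t.1)).[? r]%fmap = Some e.
  by rewrite fnd_subtable rt.
by case: st => [T0|/(_ _ _ srt)//]; move: srt; rewrite T0 fnd_fmap0.
Qed.

Lemma sound_pathP T t :
  (forall r e, (rows T).[? r]%fmap = Some e ->
     all (fun q => entry T r q.1 == Some q.2) t.1 -> e = t.2) ->
  sound_path T t.
Proof.
by move=> st; right=> r e; rewrite fnd_subtable; case: ifP => // rt /st; apply.
Qed.

Lemma mem_paths G t :
  reflect (exists i, t \in node_paths (@root_child _ G i)) (t \in paths G).
Proof.
apply: (iffP flatten_mapP) => [[i _ ti]|[i ti]]; first by exists i.
by exists i => //; rewrite mem_enum.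
Qed.

Lemma node_paths_attrs (v : node k) t q :
  t \in node_paths v -> q \in t.1 -> q.1 \in node_attrs v.
Proof.
elim: v t => [d|f m lbl child IH] t /=; first by rewrite inE => /eqP ->.
move=> /flatten_mapP[i _ /mapP[u ui ->]] /=; rewrite !inE => /orP[/eqP->/=|qu].
  by rewrite eqxx.
apply/orP; right; apply/flatten_mapP; exists i; first by rewrite mem_enum.
exact: IH ui qu.
Qed.

Lemma paths_attrs G t q : t \in paths G -> q \in t.1 -> q.1 \in attrs G.
Proof.
move=> /mem_paths[i ti] qt; apply/flatten_mapP; exists i; first by rewrite mem_enum.
exact: node_paths_attrs ti qt.
Qed.

Fixpoint chain w : node k :=
  if w is q :: w' then @Query k q.1 0 (fun=> q.2) (fun=> chain w')
  else Terminal k true.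

(** Splitting the list of paths into [w] and [s] guarantees that the root has a leaving edge. *)
Definition fan w (s : seq (seq (nat * 'I_k))) : dtree k :=
  @DTree k (size s) (fun i => chain (nth [::] (w :: s) i)).

Lemma node_paths_chain w : node_paths (chain w) = [:: (w, true)].
Proof. by elim: w => //= -[f d] w ->; rewrite enum_ordSl enum_ord0. Qed.

Lemma node_attrs_chain w : node_attrs (chain w) = unzip1 w.
Proof. by elim: w => //= -[f d] w ->; rewrite enum_ordSl enum_ord0 /= cats0. Qed.

Lemma mem_paths_fan w s t :
  (t \in paths (fan w s)) = (t.2 == true) && (t.1 \in w :: s).
Proof.
apply/mem_paths/andP => [[i]|[/eqP t2 /(nthP [::])[i i_s ti]]].
  rewrite node_paths_chain inE => /eqP -> /=; split=> //.
  by rewrite -[_ \in _]/(_ \in w :: s) mem_nth.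
by exists (Ordinal i_s); rewrite /= node_paths_chain inE ti -t2; case: (t).
Qed.

Lemma attrs_fan w s f :
  f \in attrs (fan w s) -> exists2 v, v \in w :: s & f \in unzip1 v.
Proof.
move=> /flatten_mapP[i _]; rewrite /= node_attrs_chain => fi.
by exists (nth [::] (w :: s) i) => //; rewrite mem_nth.
Qed.

Lemma minimum0 : minimum set0 = 0.
Proof. by rewrite /minimum; case: xgetP => // m _ [[]]. Qed.

Lemma minimum_le S n : S n -> minimum S <= n.
Proof. by move=> Sn; have [|_] := @minimumP S; [exists n|apply]. Qed.

Variable psi : seq nat -> nat.

Lemma psi_tree_le G n :
  (forall t, t \in paths G -> psi (unzip1 t.1) <= n) -> psi_tree psi G <= n.
Proof. by move=> tn; apply/bigmax_leqP_seq => t /tn. Qed.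

Lemma le_psi_tree G t : t \in paths G -> psi (unzip1 t.1) <= psi_tree psi G.
Proof. by move=> tG; rewrite /psi_tree (leq_bigmax_seq _ tG). Qed.

Lemma not_constant_has T d : ~ @constant_tables k T ->
  exists r, (rows T).[? r]%fmap = Some d.
Proof.
move=> nT; apply: contrapT => noT; apply: nT; exists (~~ d) => r e Tr.
by case: d e noT Tr => -[] // noT Tr; case: noT; exists r.
Qed.

Lemma not_constant_Lambda T : ~ @constant_tables k T -> T != Lambda.
Proof.
by move=> /(@not_constant_has _ true)[r]; apply: contraPneq => ->; rewrite fnd_fmap0.
Qed.

Lemma psi_d_le T G : deterministic_tree_for T G -> psi_d psi T <= psi_tree psi G.
Proof.
move=> TG; rewrite /psi_d; case: ifP => // _.
by apply: minimum_le; exists G.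
Qed.

Lemma psi_s_le T G : strongly_nondeterministic_tree_for T G ->
  psi_s psi T <= psi_tree psi G.
Proof.
move=> TG; rewrite /psi_s; case: ifP => // _.
by apply: minimum_le; exists G.
Qed.

(* Keeping the complete paths of a deterministic tree that end in 1 yields a
   strongly nondeterministic one. *)
Lemma deterministic_strongly_nondeterministic T G :
  ~ @constant_tables k T -> deterministic_tree_for T G ->
  exists2 G', strongly_nondeterministic_tree_for T G' &
              psi_tree psi G' <= psi_tree psi G.
Proof.
move=> /(@not_constant_has _ true)[r Tr] [_ _ GT cover sound].
have path1 r1 : (rows T).[? r1]%fmap = Some true ->
    exists2 t, t \in paths G & t.2 /\
      r1 \in domf (rows (subtable T t.1)).
  move=> Tr1; have /cover[t tG rt] : r1 \in domf (rows T) by rewrite -fndSome Tr1.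
  exists t => //; split=> //; move: rt; rewrite mem_subtable => /andP[_ rt].
  by rewrite -(sound_path_fnd (sound _ tG) Tr1 rt).
pose s := [seq t.1 | t <- paths G & t.2].
(* A nonconstant table has a row with decision 1, so at least one path is kept and [fan] applies. *)
have [t tG [t2 rt]] := path1 _ Tr.
have ts : t.1 \in s by apply: map_f; rewrite mem_filter t2.
have sP v : v \in s -> (v, true) \in paths G.
  by move=> /mapP[[u b]]; rewrite mem_filter => /andP[/= b1 ub ->]; rewrite -b1.
case Es: s ts => [//|w s'] _.
exists (fan w s'); first split.
- by move=> u; rewrite mem_paths_fan => /andP[/eqP].
- move=> f /attrs_fan[v]; rewrite -Es => /sP vG /mapP[q qv ->].
  by apply: GT; apply: paths_attrs vG qv.
- move=> r1 /path1[u uG [u2 ru]]; exists u => //.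
  by rewrite mem_paths_fan u2 -Es map_f// mem_filter u2.
- move=> [v b]; rewrite mem_paths_fan -Es => /andP[/= /eqP-> /sP].
  exact: sound.
apply: psi_tree_le => u; rewrite mem_paths_fan -Es => /andP[_ /sP uG].
exact: le_psi_tree uG.
Qed.

(** Since [minimum] is 0 on the empty set, positivity of [psi_d] ensures that the minimum is
    attained by some deterministic tree, which can then be pruned. *)
Lemma psi_s_le_psi_d T : 0 < psi_d psi T -> psi_s psi T <= psi_d psi T.
Proof.
have [/asboolP cT|/asboolP nT] := boolP `[< @constant_tables k T >].
  by rewrite /psi_s mem_set.
set S := [set psi_tree psi G | G in deterministic_tree_for T].
have -> : psi_d psi T = minimum S by rewrite /psi_d (negbTE (not_constant_Lambda nT)).
move=> S0.
have [G TG <-] : S (minimum S).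
  have [|//] := @minimumP S; apply: contrapT => S_0; move: S0.
  by have -> : S = set0; [apply: contrapT => /eqP/set0P|rewrite minimum0].
have [G' TG' le_G'] := deterministic_strongly_nondeterministic nT TG.
exact: leq_trans (psi_s_le TG') le_G'.
Qed.

End Trees.

(** * The function [F_fun] as a maximum over a finite set *)

Section Function.
Context {k : nat}.
Variables (psi : seq nat -> nat) (A : set (table k)).

Lemma leq_max_fset_set (S : set nat) n :
  finite_set S -> S n -> n <= \max_(x <- fset_set S) x.
Proof.
by move=> Sfin Sn; apply: (@leq_bigmax_seq _ _ xpredT id); rewrite ?in_fset_set ?inE.
Qed.

Lemma F_fun_le n y : F_fun psi A n = Some y ->
  forall T, A T -> psi_s psi T <= n -> psi_d psi T <= y.
Proof.
rewrite /F_fun; case: asboolP => // Sfin [<-] T AT Tn.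
by apply: leq_max_fset_set Sfin _; exists T.
Qed.

Lemma F_fun_gt n y m : F_fun psi A n = Some y -> m < y ->
  exists T, [/\ A T, psi_s psi T <= n & m < psi_d psi T].
Proof.
rewrite /F_fun; case: asboolP => // Sfin [<-] my; apply: contrapT => noT.
move: my; rewrite ltnNge => /negP; apply; apply/bigmax_leqP_seq => x.
rewrite in_fset_set// inE => -[T [AT Tn] <-] _.
by rewrite leqNgt; apply/negP => mT; apply: noT; exists T.
Qed.

(** The upper bound also makes the set of values finite, so [F_fun] is defined. For [y = 0] it
    already forces the maximum to be 0, so a witness is asked for only when [y] is positive. *)
Lemma F_fun_eq n y :
  (forall T, A T -> psi_s psi T <= n -> psi_d psi T <= y) ->
  (0 < y -> exists T, [/\ A T, psi_s psi T <= n & y <= psi_d psi T]) ->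
  F_fun psi A n = Some y.
Proof.
move=> ub attained; rewrite /F_fun; case: asboolP => [Sfin|[]]; last first.
  apply: (@sub_finite_set _ _ `I_y.+1); last exact: finite_II.
  by move=> _ [T [AT Tn] <-] /=; rewrite ltnS; exact: ub.
congr Some; apply/eqP; rewrite eqn_leq; apply/andP; split.
  apply/bigmax_leqP_seq => x; rewrite in_fset_set// inE => -[T [AT Tn] <-] _.
  exact: ub.
case: (posnP y) attained => [-> //|y0 /(_ isT)[T [AT Tn yT]]].
apply: leq_trans yT _.
by apply: leq_max_fset_set Sfin _; exists T.
Qed.

End Function.

(** * Bounded functions versus lower bounds by [H_fun] *)

Lemma finite_set_nat_le (D : set nat) :
  finite_set D -> exists N, forall n, D n -> n <= N.
Proof.
by move=> Dfin; exists (\max_(x <- fset_set D) x) => n Dn; exact: leq_max_fset_set.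
Qed.

Lemma H_funP (D : set nat) n : infinite_set D ->
  H_fun D n = 0 \/ (D (H_fun D n) /\ H_fun D n <= n).
Proof.
move=> /enumerationP[_ De]; rewrite /H_fun /=.
have [|e0] := ltnP; first by left.
right; split; first by rewrite -[X in X _]De; eexists.
(* If [xget] falls back on the index 0, the bound is [e0]. *)
by case: xgetP => [i _ /andP[]|].
Qed.

Lemma F_fun_dichotomy {k : nat} (psi : seq nat -> nat) (A : set (table k)) g :
  (forall n, F_fun psi A n = Some (g n)) ->
  {homo g : m n / m <= n} /\
  ((exists c : nat, forall n, g n <= c) \/
   (exists2 D : set nat, infinite_set D & forall n, H_fun D n <= g n)).
Proof.
move=> Fg.
have gmono : {homo g : m n / m <= n}.
  move=> m n mn; rewrite leqNgt; apply/negP => /(F_fun_gt (Fg m))[T [AT Tm]].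
  by rewrite ltnNge (F_fun_le (Fg n))// (leq_trans Tm).
split=> //; have [|unbounded] := pselect (exists c, forall n, g n <= c); first by left.
right; set D := [set n | n <= g n].
(* If [N] bounded [D], then [g N] would bound [g]. *)
have Dinf : infinite_set D.
  move=> /finite_set_nat_le[N DN].
  apply: unbounded; exists (g N) => n; rewrite leqNgt; apply/negP.
  move=> /(F_fun_gt (Fg n))[T [AT _ gT]].
  have NT : N < psi_s psi T.
    by rewrite ltnNge; apply: contraL gT => TN; rewrite -leqNgt (F_fun_le (Fg N)).
  (* The point [psi_s psi T] lies in [D], being at most [psi_d psi T], hence at most the value of
     [g] at it; so it cannot exceed [N]. *)
  move: NT; rewrite ltnNge => /negP; apply; apply: DN => /=.
  apply: leq_trans (psi_s_le_psi_d (leq_ltn_trans (leq0n _) gT)) _.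
  exact: (F_fun_le (Fg _)).
exists D => // n.
case: (H_funP n Dinf) => [->//|[DH Hn]]; exact: leq_trans DH (gmono _ _ Hn).
Qed.

(** * The tree querying all columns; bounds on [psi_d] and [psi_s] *)

Section FullTree.
Context {k : nat}.
Implicit Types (T : table k.+1) (G : dtree k.+1).

(** [dec] is specialized to each answer on the way down, so a terminal node holds its value at the
    whole word of answers. *)
Fixpoint full_node (cols : seq nat) (dec : seq 'I_k.+1 -> bool) : node k.+1 :=
  if cols is f :: cols' then
    Query f id (fun i => full_node cols' (fun r => dec (i :: r)))
  else Terminal _ (dec [::]).

(** The default [false] labels words that are not rows; no row follows their paths. *)
Definition full_tree T : dtree k.+1 :=
  @DTree _ 0
    (fun=> full_node (columns T) (fun r => odflt false (rows T).[? r]%fmap)).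

Lemma det_full_node cols dec : det_node (full_node cols dec).
Proof. by elim: cols dec => //= f cols IH dec; split => [|i]; [exact: inj_id|exact: IH]. Qed.

Lemma node_attrs_full_node cols dec :
  {subset node_attrs (full_node cols dec) <= cols}.
Proof.
elim: cols dec => // g cols IH dec f; rewrite /= !inE => /orP[->//|].
by move=> /flatten_mapP[i _ /IH ->]; rewrite orbT.
Qed.

Lemma mem_full_node cols dec t :
  t \in node_paths (full_node cols dec) <->
  exists2 r, size r = size cols & t = (zip cols r, dec r).
Proof.
elim: cols dec t => [|f cols IH] dec t /=.
  rewrite inE; split=> [/eqP->|[r /size0nil-> ->]//]; by exists [::].
split=> [/flatten_mapP[i _ /mapP[u /IH[r sr ->] ->]]|[[//|i r] [sr] ->]].
  by exists (i :: r); rewrite //= sr.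
apply/flatten_mapP; exists i; first by rewrite mem_enum.
apply/mapP; exists (zip cols r, dec (i :: r)) => //.
by apply/IH; exists r.
Qed.

(** As columns are pairwise different, the [i]-th condition concerns exactly the [i]-th entry of
    [r]. *)
Lemma all_entry_zip T r s : size r = size (columns T) -> size s = size (columns T) ->
  all (fun q => entry T r q.1 == Some q.2) (zip (columns T) s) = (r == s).
Proof.
move=> sr ss; have zs : size (zip (columns T) s) = size (columns T).
  by rewrite size_zip ss minnn.
have E i : i < size (columns T) ->
    (entry T r (nth (0, ord0) (zip (columns T) s) i).1 ==
     Some (nth (0, ord0) (zip (columns T) s) i).2) = (nth ord0 r i == nth ord0 s i).
  move=> iT; rewrite nth_zip// /entry index_uniq ?uniq_columns//.
  by rewrite onthE (nth_map ord0) ?sr.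
apply/(all_nthP (0, ord0))/eqP => [rs|-> i]; last first.
  rewrite zs => iT; rewrite nth_zip//= /entry index_uniq ?uniq_columns//.
  by rewrite onthE (nth_map ord0) ?ss.
apply: (@eq_from_nth _ ord0); first by rewrite sr ss.
by move=> i; rewrite sr => iT; apply/eqP; rewrite -E// rs// zs.
Qed.

Lemma mem_full_tree T t : t \in paths (full_tree T) <->
  exists2 r, size r = size (columns T) &
             t = (zip (columns T) r, odflt false (rows T).[? r]%fmap).
Proof.
split=> [/mem_paths[i /mem_full_node//]|tT].
by apply/mem_paths; exists ord0; apply/mem_full_node.
Qed.

(** Each complete path fixes all entries, so at most one row follows it and soundness is
    immediate. *)
Lemma deterministic_full_tree T : deterministic_tree_for T (full_tree T).
Proof.
split=> //.
- by move=> i; exact: det_full_node.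
- by move=> f /flatten_mapP[i _ /node_attrs_full_node].
- move=> r rT; have sr := size_rows rT.
  exists (zip (columns T) r, odflt false (rows T).[? r]%fmap).
    by apply/mem_full_tree; exists r.
  by rewrite mem_subtable rT all_entry_zip//=.
- move=> t /mem_full_tree[s ss ->]; apply: sound_pathP => /= r e Tr.
  have rT : r \in domf (rows T) by rewrite -fndSome Tr.
  by rewrite all_entry_zip ?(size_rows rT)// => /eqP <-; rewrite Tr.
Qed.

Variable psi : seq nat -> nat.

Lemma psi_d_le_columns T : psi_d psi T <= psi (columns T).
Proof.
apply: leq_trans (psi_d_le psi (deterministic_full_tree T)) _.
apply: psi_tree_le => t /mem_full_tree[r sr ->] /=.
by rewrite unzip1_zip// sr.
Qed.

Lemma psi_d_constant T : psi [::] = 0 -> @constant_tables k.+1 T -> psi_d psi T = 0.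
Proof.
move=> psi0 [d Td]; apply/eqP; rewrite -leqn0.
pose G := @DTree k.+1 0 (fun=> Terminal _ d).
have GE t : t \in paths G -> t = ([::], d).
  by move=> /mem_paths[i]; rewrite inE => /eqP.
apply: leq_trans (@psi_d_le _ psi T G _) _; last first.
  by apply: psi_tree_le => t /GE ->; rewrite psi0.
split=> //.
- by move=> f /flatten_mapP[].
- move=> r rT; exists ([::], d); last by rewrite mem_subtable rT.
  by apply/mem_paths; exists ord0; rewrite inE.
- by move=> t /GE ->; apply: sound_pathP => r e /Td.
Qed.

(* A strongly nondeterministic tree for a nonconstant table cannot accept with
   the empty path, hence pays for at least one attribute of the table. *)
Lemma le_psi_s T n : ~ @constant_tables k.+1 T ->
  (forall f a, f \in columns T -> f \in a -> n <= psi a) -> n <= psi_s psi T.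
Proof.
move=> nT psi_n; rewrite /psi_s; case: ifPn => [/set_mem//|_].
set S := [set _ | _ in _].
have [|[G [_ GT cover sound] <-] _] := @minimumP S.
  (* Pruning the full tree shows that the minimum is taken over a nonempty set. *)
  have [G TG _] := deterministic_strongly_nondeterministic psi nT
    (deterministic_full_tree T).
  by exists (psi_tree psi G), G.
have [r Tr] := not_constant_has true nT.
have [[w d] tG rt] := cover _ Tr.
apply: leq_trans (le_psi_tree psi tG).
case: w => [|q w] in tG rt *; last first.
  apply: (psi_n q.1); last by rewrite inE eqxx.
  by apply: GT; apply: paths_attrs tG _; rewrite inE eqxx.
by case: nT; exists d => r1 e Tr1; exact: sound_path_fnd (sound _ tG) Tr1 _.
Qed.

End FullTree.

(** * The extremal tables: cheap to accept, expensive to decide *)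

Section OrTable.
Context {k : nat}.

(** With at least two letters, [ord_max] differs from [ord0], so the zero row of positive length has
    decision 0. *)
Definition or_rows m : {fmap seq 'I_k.+2 -> bool} :=
  [fmap r : [fset tval t | t : m.-tuple 'I_k.+2]%fset => ord_max \in val r]%fmap.

Definition or_table (cols : seq nat) : table k.+2 :=
  mk_table cols (or_rows (size cols)).

Lemma mem_or_rows m r : (r \in domf (or_rows m)) = (size r == m).
Proof.
apply/imfsetP/eqP => [[t _ ->]|sr]; first exact: size_tuple.
by exists (tcast sr (in_tuple r)); rewrite // val_tcast.
Qed.

Lemma fnd_or_rows m r :
  (or_rows m).[? r]%fmap = if size r == m then Some (ord_max \in r) else None.
Proof.
rewrite -mem_or_rows; case: ifPn => rT; last by rewrite not_fnd.
by rewrite in_fnd ffunE.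
Qed.

Variable cols : seq nat.
Hypotheses (cols_uniq : uniq cols) (cols0 : 0 < size cols).

Lemma raw_or_table : raw_of_table (or_table cols) = (cols, or_rows (size cols)).
Proof.
apply: val_mk_table; apply/and3P; split => //=.
  by apply/forallP => -[r /=]; rewrite mem_or_rows.
rewrite /nilp eqn0Ngt cols0 eq_sym; apply/eqP/negbTE/fset0Pn.
by exists (nseq (size cols) ord0); rewrite mem_or_rows size_nseq.
Qed.

Lemma columns_or_table : columns (or_table cols) = cols.
Proof. by rewrite /columns raw_or_table. Qed.

Lemma fnd_or_table r : (rows (or_table cols)).[? r]%fmap =
  if size r == size cols then Some (ord_max \in r) else None.
Proof. by rewrite /rows raw_or_table fnd_or_rows. Qed.

Lemma entry_or_table r f : size r = size cols -> f \in cols ->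
  entry (or_table cols) r f = Some (nth ord0 r (index f cols)).
Proof.
move=> sr fc; rewrite /entry columns_or_table onthE (nth_map ord0)//.
by rewrite sr index_mem.
Qed.

Variable psi : seq nat -> nat.

(** One path per column, testing only whether its entry is [ord_max], covers exactly the rows with
    decision 1. *)
Lemma psi_s_or_table n : (forall f, f \in cols -> psi [:: f] <= n) ->
  psi_s psi (or_table cols) <= n.
Proof.
move=> psi_n; pose s := [seq [:: (f, ord_max : 'I_k.+2)] | f <- cols].
have mem_s f : f \in cols -> [:: (f, ord_max)] \in s by move=> fc; exact: map_f.
have sP v : v \in s -> exists2 f, f \in cols & v = [:: (f, ord_max)] by move/mapP.
have : 0 < size s by rewrite size_map.
case Es: s => [//|w s'] _.
apply: leq_trans (@psi_s_le _ psi _ (fan w s') _) _; last first.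
  apply: psi_tree_le => t; rewrite mem_paths_fan -Es => /andP[_ /sP[f fc ->]].
  exact: psi_n.
split.
- by move=> t; rewrite mem_paths_fan => /andP[/eqP].
- move=> f /attrs_fan[v]; rewrite -Es columns_or_table => /sP[g gc ->].
  by rewrite inE => /eqP ->.
- move=> r; rewrite fnd_or_table; case: eqP => // sr -[] /(nthP ord0)[i ir ri].
  have ic : i < size cols by rewrite -sr.
  exists ([:: (nth 0 cols i, ord_max)], true).
    by rewrite mem_paths_fan -Es mem_s// mem_nth.
  rewrite mem_subtable -fndSome fnd_or_table sr eqxx /= andbT.
  by rewrite entry_or_table ?mem_nth// index_uniq// ri.
- move=> [v b]; rewrite mem_paths_fan -Es => /andP[/= /eqP-> /sP[f fc ->]].
  apply: sound_pathP => r e; rewrite fnd_or_table /= andbT.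
  case: eqP => // sr [<-]; rewrite entry_or_table// => /eqP[fr].
  by rewrite -fr mem_nth// sr index_mem.
Qed.

(* The path of the zero row must query every column: otherwise it is also the
   path of a row whose only nonzero entry lies in the column not queried. *)
Lemma psi_d_or_table : (forall a, size a <= psi a) ->
  size cols <= psi_d psi (or_table cols).
Proof.
move=> psi_size; set T := or_table cols.
pose z := nseq (size cols) (ord0 : 'I_k.+2).
have Tz : (rows T).[? z]%fmap = Some false.
  by rewrite fnd_or_table size_nseq eqxx mem_nseq andbF.
rewrite /psi_d ifN; last by apply: contraPneq Tz => ->; rewrite fnd_fmap0.
set S := [set _ | _ in _].
have [|[G [_ _ _ cover sound] <-] _] := @minimumP S.
  by exists (psi_tree psi (full_tree T)), (full_tree T); first exact: deterministic_full_tree.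
have zT : z \in domf (rows T) by rewrite -fndSome Tz.
have [t tG] := cover _ zT; rewrite mem_subtable zT /= => zt.
apply: leq_trans (le_psi_tree psi tG).
(* Columns are pairwise different, so it suffices that each of them occurs on the path. *)
apply: leq_trans (psi_size _); apply: uniq_leq_size => // f fc.
apply: contrapT => /negP ft.
have t2 := sound_path_fnd (sound _ tG) Tz zt.
pose u := set_nth ord0 z (index f cols) (ord_max : 'I_k.+2).
have su : size u = size cols.
  by rewrite size_set_nth size_nseq (maxn_idPr _)// index_mem.
have Tu : (rows T).[? u]%fmap = Some true.
  rewrite fnd_or_table su eqxx; congr Some; apply/(nthP ord0); exists (index f cols).
    by rewrite su index_mem.
  by rewrite nth_set_nth /= eqxx.
suff ut : all (fun q => entry T u q.1 == Some q.2) t.1.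
  by have := sound_path_fnd (sound _ tG) Tu ut; rewrite -t2.
apply/allP => q qt; move/allP/(_ _ qt): zt.
have qf : q.1 != f by apply: contraNneq ft => <-; exact: map_f.
(* At an attribute outside [cols], [entry] is [None] for both rows, so they agree there too. *)
have [qc|qc] := boolP (q.1 \in cols); last first.
  by rewrite /entry columns_or_table !onth_default// ?su ?size_nseq memNindex.
rewrite !entry_or_table ?size_nseq// nth_set_nth /= ifN//.
by apply: contra_neq qf => /(congr1 (nth 0 cols)); rewrite !nth_index.
Qed.

End OrTable.

(** * Closed classes defined by a condition on the columns *)

Section Columns.
Context {k : nat}.
Implicit Types T : table k.

Lemma columns_opI D T : {subset columns (opI D T) <= columns T} /\
  size (columns (opI D T)) <= size (columns T).
Proof.
have [cD|cD] := boolP (nilp [seq f <- columns T | f \notin D]).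
  by rewrite /opI mk_table_Lambda ?cD.
rewrite {1 3}/columns (val_opI cD) /=; split; last by rewrite size_filter count_size.
by move=> f; rewrite mem_filter => /andP[].
Qed.

Lemma columns_opJ T nu : columns (@opJ _ T nu) = columns T.
Proof. by rewrite {1}/columns val_opJ. Qed.

Lemma mk_tableK T : mk_table (columns T) (rows T) = T.
Proof. by rewrite /mk_table /columns /rows -surjective_pairing; exact: valKd. Qed.

(** With no column deleted, each group of coinciding rows is a single row, whose decision is the
    minimum. *)
Lemma opI_nil T : opI [::] T = T.
Proof.
rewrite -[RHS]mk_tableK /opI /=.
have c_nil : [seq f <- columns T | f \notin [::]] = columns T.
  by apply/all_filterP/allP.
have restrE r : r \in domf (rows T) ->
    mask [seq f \notin [::] | f <- columns T] r = r.
  move=> /size_rows sr; rewrite -[RHS](@mask_true _ r (size (columns T))) ?sr//.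
  by congr mask; elim: (columns T) => //= f c ->.
rewrite c_nil; congr mk_table; apply/fmapP => r.
have [rT|rT] := boolP (r \in domf (rows T)).
  have rI : r \in [fset mask [seq f \notin [::] | f <- columns T] r0
                  | r0 in domf (rows T)]%fset.
    by apply/imfsetP; exists r; rewrite ?restrE.
  rewrite (in_fnd rT) (in_fnd (f := [fmap _ => _]%fmap) rI) ffunE; congr Some => /=.
  apply/forallP/idP => [/(_ [` rT]%fset)|Tr r0]; first by rewrite restrE// eqxx.
  apply/implyP; rewrite restrE ?(valP r0)// => /eqP r0r.
  by rewrite (_ : r0 = [` rT]%fset)//; apply: val_inj.
rewrite !not_fnd//; apply: contra rT => /imfsetP[r0 /= r0T ->].
by rewrite restrE.
Qed.

Lemma table_closure1_refl T : table_closure1 T T.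
Proof.
exists [::] => //; rewrite opI_nil.
(* Take the decisions of [T] itself as [nu]; [opJ] reads it only at rows of [T]. *)
exists (fun r => odflt false (rows T).[? tval r]%fmap).
apply: val_inj; rewrite /= val_opJ; case: T => -[c r] /= wf.
congr pair; apply/fmapP => s; have [sr|sr] := boolP (s \in domf r).
  by rewrite (in_fnd (f := [fmap _ => _]%fmap) sr) ffunE in_fnd.
by rewrite !not_fnd.
Qed.

(** [opI] can only remove columns and [opJ] keeps them, while [Lambda] makes the class nonempty. *)
Lemma closed_class_columns (P : seq nat -> Prop) : P [::] ->
  (forall c c', {subset c' <= c} -> size c' <= size c -> P c -> P c') ->
  closed_class [set T : table k | P (columns T)].
Proof.
move=> P0 Psub; split; first by exists Lambda.
apply/seteqP; split => [T [T0 PT0 [D _ [nu ->]]]|T PT].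
  have [sub le_size] := columns_opI D T0.
  by rewrite /= columns_opJ; exact: Psub PT0.
by exists T => //; exact: table_closure1_refl.
Qed.

End Columns.

(** * The measure by groups of attributes, and realization of [phi] *)

Definition group_measure (a : seq nat) : nat :=
  maxn (size a) (\max_(f <- a) logn 2 f).

Lemma bounded_group_measure : bounded_measure group_measure.
Proof.
split=> [|a]; last exact: leq_maxl.
split=> [a|a b ab|a b|a b].
- split=> [/eqP|->]; last by rewrite /group_measure big_nil.
  by rewrite -leqn0 geq_max leqn0 => /andP[/nilP].
- by rewrite /group_measure (perm_size ab) (perm_big _ ab).
- rewrite /group_measure size_cat big_cat /= geq_max !leq_max leq_addr /=.
  by rewrite leqnn !orbT.
rewrite /group_measure size_cat big_cat /= !geq_max leq_add ?leq_maxl//=.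
by rewrite (leq_trans (leq_maxr _ _) (leq_addr _ _)) (leq_trans (leq_maxr _ _) (leq_addl _ _)).
Qed.

(** Odd multiples of [2 ^ n] are the positive numbers of 2-adic valuation [n]. *)
Definition group_attrs n m : seq nat := [seq 2 ^ n * i.*2.+1 | i <- iota 0 m].

Lemma group_attrs_uniq n m : uniq (group_attrs n m).
Proof.
rewrite map_inj_uniq ?iota_uniq// => i j /eqP.
by rewrite eqn_pmul2l ?expn_gt0// => /eqP[] /double_inj.
Qed.

Lemma logn_group_attrs n m f : f \in group_attrs n m -> logn 2 f = n.
Proof.
move=> /mapP[i _ ->]; rewrite lognM ?expn_gt0// pfactorK// logn_coprime ?addn0//.
by rewrite coprime2n /= odd_double.
Qed.

Lemma F_fun_realizable (k : nat) (phi : nat -> nat) :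
  {homo phi : m n / m <= n} -> (forall n, n <= phi n) -> phi 0 = 0 ->
  exists (psi : seq nat -> nat) (A : set (table k.+2)),
    [/\ bounded_measure psi, closed_class A &
        forall n, F_fun psi A n = Some (phi n)].
Proof.
move=> phi_mono phi_ge phi0.
pose P c := exists n, (forall f, f \in c -> logn 2 f = n) /\ size c <= phi n.
exists group_measure, [set T : table k.+2 | P (columns T)].
split; first exact: bounded_group_measure.
  apply: closed_class_columns => [|c c' sub le_size [n [cn sn]]]; first by exists 0.
  by exists n; split=> [f /sub/cn//|]; exact: leq_trans sn.
move=> n; apply: F_fun_eq => [T [m [Tm sm]] Tn|phi_n0].
  have [/asboolP cT|/asboolP nT] := boolP `[< @constant_tables k.+2 T >].
    by rewrite psi_d_constant// /group_measure big_nil.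
  (* Any word containing a column of [T] costs at least the group number [m]. *)
  have mn : m <= n.
    apply: leq_trans Tn; apply: le_psi_s => // f a fT fa.
    rewrite leq_max -[X in X <= \max_(_ <- _) _](Tm f)//.
    by rewrite (@leq_bigmax_seq _ _ xpredT) ?orbT.
  (* The length is at most [phi m <= phi n], and the group numbers are [m <= n <= phi n]. *)
  apply: leq_trans (psi_d_le_columns _ _) _; rewrite geq_max.
  rewrite (leq_trans sm) ?phi_mono//=; apply/bigmax_leqP_seq => f /Tm -> _.
  exact: leq_trans mn (phi_ge n).
(* A single query costs the maximum of 1 and [n], which is [n] only for positive [n]. *)
have n0 : 0 < n by case: n phi_n0 => [|//]; rewrite phi0.
have size_c : size (group_attrs n (phi n)) = phi n by rewrite size_map size_iota.
have c_uniq := group_attrs_uniq n (phi n).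
have c0 : 0 < size (group_attrs n (phi n)) by rewrite size_c.
exists (or_table (group_attrs n (phi n))); split.
- rewrite /= columns_or_table//; exists n; split; last by rewrite size_c.
  by move=> f; exact: logn_group_attrs.
- apply: psi_s_or_table => // f fc.
  by rewrite /group_measure big_seq1 (logn_group_attrs fc) geq_max n0 leqnn.
- rewrite -[X in X <= _]size_c; apply: psi_d_or_table => // a; exact: leq_maxl.
Qed.

Theorem theorem5 (k : nat) (hk : 2 <= k) :
  (forall (psi : seq nat -> nat) (A : set (table k)) (g : nat -> nat),
     bounded_measure psi -> closed_class A ->
     (forall n, F_fun psi A n = Some (g n)) ->
     {homo g : m n / m <= n} /\
     ((exists c : nat, forall n, g n <= c) \/
      (exists2 D : set nat, infinite_set D & forall n, H_fun D n <= g n))) /\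
  (forall phi : nat -> nat,
     {homo phi : m n / m <= n} -> (forall n, n <= phi n) -> phi 0 = 0 ->
     exists (psi : seq nat -> nat) (A : set (table k)),
       [/\ bounded_measure psi, closed_class A &
           forall n, F_fun psi A n = Some (phi n)]).
Proof.
split=> [psi A g _ _|]; first exact: F_fun_dichotomy.
by case: k hk => [|[|k]] // _; exact: F_fun_realizable.
Qed.
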